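(* (Density.) Let $X,Y$ be sets. (1) If $f,g:\mathcal{S}X\to\mathcal{S}Y$ are global and $f(\lambda\_.x)=g(\lambda\_.x)$ for all $x\in X$, then $f=g$. (2) If $f:\mathcal{S}X\to\mathcal{S}Y$ is global and $f(\alpha)$ is an individual for every constant individual $\alpha$, then $f(\beta)$ is an individual for every individual $\beta$.
   Context: $\mathbb{S}$ is a set of states partially ordered by inclusion $\sqsubseteq$ (states are finite sets of triples $\langle P,\vec m,n\rangle$, $P$ a primitive recursive predicate symbol, satisfying $P(\vec m,n)$ in the standard model and at most one $n$ per $(P,\vec m)$). $\mathcal{S}X$ denotes the set of functions $\mathbb{S}\to X$; $\lambda\_.x$ denotes the constant function with value $x$, and such elements are called constant individuals. A weakly increasing sequence is $\sigma:\mathbb{N}\to\mathbb{S}$ with $\sigma(i)\sqsubseteq\sigma(j)$ for $i\le j$. An individual (strongly convergent element) is $\alpha\in\mathcal{S}X$ such that for every weakly increasing $\sigma$ the sequence $\alpha(\sigma(i))$ is eventually constant. A function $f:\mathcal{S}X\to\mathcal{S}Y$ is global (has global state) if $f(\alpha)(s)=f(\lambda\_.\alpha(s))(s)$ for all $\alpha\in\mathcal{S}X$, $s\in\mathbb{S}$. *)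

(* Defs.v *)
From mathcomp Require Import all_boot.
From mathcomp Require Import boolp classical_sets functions cardinality.

Set Implicit Arguments.
Unset Strict Implicit.
Unset Printing Implicit Defensive.

Local Open Scope classical_set_scope.

Inductive primrec : nat -> Type :=
| PRzero n : primrec n
| PRsucc : primrec 1
| PRproj n (i : 'I_n) : primrec n
| PRcomp m n (f : primrec m) (g : {ffun 'I_m -> primrec n}) : primrec n
| PRrec n (f : primrec n) (g : primrec n.+2) : primrec n.+1.

(* PRrec recurses on the first argument:
   h (0, v) = f v   and   h (k + 1, v) = g (k, h (k, v), v). *)
Fixpoint pr_eval n (f : primrec n) : n.-tuple nat -> nat :=
  match f in primrec n return n.-tuple nat -> nat with
  | PRzero _ => fun=> 0
  | PRsucc => fun v => (thead v).+1
  | PRproj _ i => fun v => tnth v i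
  | PRcomp m _ f g => fun v => pr_eval f [tuple pr_eval (g i) v | i < m]
  | PRrec _ f g => fun v =>
      iteri (thead v)
        (fun k r => pr_eval g [tuple of k :: r :: behead_tuple v])
        (pr_eval f (behead_tuple v))
  end.

(* A k-ary primitive recursive predicate symbol is given by a primitive
   recursive definition of a function; the predicate holds in the standard
   model where this function does not vanish. *)
Definition primpred (k : nat) : Type := primrec k.

Definition holds k (P : primpred k) (v : k.-tuple nat) : Prop :=
  pr_eval P v <> 0.

Record triple := Triple {
  triple_arity : nat;
  triple_sym : primpred triple_arity.+1;
  triple_args : triple_arity.-tuple nat;
  triple_val : nat }.

Record state := State {
  state_set :> set triple;
  state_finite : finite_set state_set;
  state_sound : forall k (P : primpred k.+1) (m : k.-tuple nat) n,
    state_set (Triple P m n) -> holds P (rcons_tuple m n);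
  state_functional : forall k (P : primpred k.+1) (m : k.-tuple nat) n n',
    state_set (Triple P m n) -> state_set (Triple P m n') -> n = n' }.

Definition state_le (s t : state) : Prop := state_set s `<=` state_set t.

Definition weakly_increasing (sigma : nat -> state) : Prop :=
  forall i j, i <= j -> state_le (sigma i) (sigma j).

Definition eventually_constant (X : Type) (u : nat -> X) : Prop :=
  exists n, forall m, n <= m -> u m = u n.

Definition Sfun (X : Type) : Type := state -> X.

Definition const_ind (X : Type) (x : X) : Sfun X := fun=> x.

Definition is_constant (X : Type) (alpha : Sfun X) : Prop :=
  exists x, alpha = const_ind x.

Definition individual (X : Type) (alpha : Sfun X) : Prop :=
  forall sigma : nat -> state, weakly_increasing sigma ->
    eventually_constant (fun i => alpha (sigma i)).

Definition global (X Y : Type) (f : Sfun X -> Sfun Y) : Prop :=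
  forall (alpha : Sfun X) (s : state), f alpha s = f (const_ind (alpha s)) s.

(* Main.v *)
Require Import Defs.
From mathcomp Require Import all_boot.
From mathcomp Require boolp.

(** Globality reduces the value of [f alpha] at a state to that of [f] at a constant individual,
    whence (1). For (2), [beta] stabilises along a given [sigma], so from some stage on a single
    constant individual matters, and its image under [f] stabilises along the same [sigma]. *)

Theorem theorem4p6 (X Y : Type) :
  (forall f g : Sfun X -> Sfun Y, global f -> global g ->
     (forall x : X, f (const_ind x) = g (const_ind x)) -> f = g) /\
  (forall f : Sfun X -> Sfun Y, global f ->
     (forall alpha : Sfun X, is_constant alpha -> individual (f alpha)) ->
     forall beta : Sfun X, individual beta -> individual (f beta)).
Proof.
split=> [f g gf gg fg | f gf fconst beta ibeta sigma wsigma].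
  by apply: boolp.funext => alpha; apply: boolp.funext => s; rewrite gf gg fg.
have [n betan] := ibeta sigma wsigma.
have constn : is_constant (const_ind (beta (sigma n))) by exists (beta (sigma n)).
have [m fm] := fconst _ constn sigma wsigma.
(* Beyond n, f beta agrees along sigma with f at one constant individual. *)
have fE k : n <= k -> f beta (sigma k) = f (const_ind (beta (sigma n))) (sigma k).
  by move=> nk; rewrite gf betan.
(* Past both stages, [fE] passes to the constant individual, whose image then keeps its value at
   [sigma m]. *)
exists (maxn n m) => k; rewrite geq_max => /andP[nk mk].
by rewrite !fE ?leq_maxl // fm // [RHS]fm ?leq_maxr.
Qed.
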